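(* Let $\mathcal{U}_a\subseteq\mathcal{U}$ and $\mathcal{Y}_a\subseteq\mathcal{Y}$ be attacked actuators and (unprotected) attacked sensors, respectively, and let $u_i\in\mathcal{U}_a$. If the Type 1 (full model knowledge) attacker can conduct a perfectly undetectable attack that actively uses $u_i$ for any realization of $[A],[B],[C]$ — that is, if for every realization $A,B,C$ there exists a perfectly undetectable attack signal using only the components $\mathcal{U}_a\cup\mathcal{Y}_a$ and actively using $u_i$ — then $|\mathcal{U}_a|+|\mathcal{Y}_a|\ge\delta_r(u_i)$ must hold.
   Context: System. For real matrices $A\in\mathbb{R}^{n_x\times n_x}$, $B\in\mathbb{R}^{n_x\times n_u}$, $C\in\mathbb{R}^{(n_y+n_e)\times n_x}$, consider, for $k\in\mathbb{Z}_{\ge0}$, $x(k+1)=Ax(k)+B_a a(k)$, $y(k)=Cx(k)+D_a a(k)$, $x(0)=0$ (control input $u=0$), where $$B_a=\begin{bmatrix} B & \mathbf{0}_{n_x\times n_y}\end{bmatrix},\qquad D_a=\begin{bmatrix}\mathbf{0}_{n_y\times n_u} & \mathbf{I}_{n_y}\\ \mathbf{0}_{n_e\times n_u} & \mathbf{0}_{n_e\times n_y}\end{bmatrix}.$$ The first $n_u$ entries of the attack $a(k)\in\mathbb{R}^{n_u+n_y}$ act on the actuators $u_1,\dots,u_{n_u}$ and the last $n_y$ on the unprotected sensors $y_1,\dots,y_{n_y}$; sensors $y_{n_y+1},\dots,y_{n_y+n_e}$ are protected and cannot be attacked. An attack $a\neq0$ is perfectly undetectable if $y(k)=0$ for all $k$;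 it actively uses $u_i$ if the entry $a^{(u_i)}(k)\neq0$ for at least one $k$. The Type 1 attacker knows $A,B,C$ and can arbitrarily read and change the attacked control signals and measurements. Structural model. $[A],[B],[C]$ are binary matrices of the same sizes as $A,B,C$. A realization is a triple of real matrices $A,B,C$ whose entries are $0$ wherever the corresponding structural entry is $0$, and arbitrary real numbers where it is $1$, subject to the standing assumption ($e_i$ canonical basis vectors): (1) $[B]=[e_{i_1}\cdots e_{i_{n_u}}]$; (2) $[B]$ has full column rank; (3) if $[B](i,j)=1$ then $B(i,j)\neq0$ in every realization; (4) $[C]=[e_{j_1}\cdots e_{j_{n_y+n_e}}]^T$. Graph. $\mathcal{X}=\{x_1,\dots,x_{n_x}\}$, $\mathcal{U}=\{u_1,\dots,u_{n_u}\}$, $\mathcal{Y}=\{y_1,\dots,y_{n_y+n_e}\}$. $\mathcal{E}_{ux}=\{(u_j,x_i):[B](i,j)\ne0\}$, $\mathcal{E}_{xx}=\{(x_j,x_i):[A](i,j)\neq0\}$, $\mathcal{E}_{xy}=\{(x_j,y_i):[C](i,j)\ne0\}$. The extended graph $\mathcal{G}_t$ is the directed graph with nodes $\mathcal{X}\cup\mathcal{U}\cup\mathcal{Y}\cup\{t\}$ and edges $\mathcal{E}_{ux}\cup\mathcal{E}_{xx}\cup\mathcal{E}_{xy}\cup\{(y_i,t):y_i\in\mathcal{Y}\}$. A vertex separator of non-adjacent nodes $v_a,v_b$ is a set of nodes not containing $v_a,v_b$ whose removal deletes all directed paths from $v_a$ to $v_b$. Robust security index. $\delta_r(u_i)$ is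 the minimum of $|\mathcal{U}'|+|\mathcal{Y}'|$ over $\mathcal{U}'\subseteq\mathcal{U}$, $\mathcal{Y}'\subseteq\mathcal{Y}$ such that $u_i\in\mathcal{U}'$, all sensors in $\mathcal{Y}'$ are unprotected, and $\mathcal{X}'\cup\mathcal{Y}'$ is a vertex separator of $u_i$ and $t$ in $\mathcal{G}_t$, where $\mathcal{X}'=\{x_j:(u_k,x_j)\in\mathcal{E}_{ux},\ u_k\in\mathcal{U}'\setminus\{u_i\}\}$. If no such pair exists, $\delta_r(u_i)=+\infty$. *)

(* Defs.v *)
From HB Require Import structures.
From mathcomp Require Import all_boot all_order all_algebra.
From mathcomp Require Import reals constructive_ereal.

Set Implicit Arguments.
Unset Strict Implicit.
Unset Printing Implicit Defensive.

Import Order.TTheory GRing.Theory Num.Theory.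
Local Open Scope ring_scope.

(* Linear system under attack.  Sensors are indexed by 'I_(ny + ne): those of
   index < ny can be attacked, the last ne are protected.  The component
   lshift ny j of an attack acts on actuator j, the component rshift nu s on
   sensor lshift ne s. *)

Section System.
Variables (R : realType) (nx nu ny ne : nat).
Variables (A : 'M[R]_nx) (B : 'M[R]_(nx, nu)) (C : 'M[R]_(ny + ne, nx)).

Definition attack_input_mx : 'M[R]_(nx, nu + ny) := row_mx B 0.

Definition attack_output_mx : 'M[R]_(ny + ne, nu + ny) := block_mx 0 1%:M 0 0.

Fixpoint state (a : nat -> 'cV[R]_(nu + ny)) (k : nat) : 'cV[R]_nx :=
  if k is k'.+1 then A *m state a k' + attack_input_mx *m a k' else 0.

Definition output (a : nat -> 'cV[R]_(nu + ny)) (k : nat) : 'cV[R]_(ny + ne) :=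
  C *m state a k + attack_output_mx *m a k.

Definition perfectly_undetectable (a : nat -> 'cV[R]_(nu + ny)) : Prop :=
  (exists k, a k != 0) /\ (forall k, output a k = 0).

End System.

Definition unprotected (ny ne : nat) (s : 'I_(ny + ne)) : bool := (s < ny)%N.

Definition uses_only (R : realType) (nu ny ne : nat)
    (U : {set 'I_nu}) (Y : {set 'I_(ny + ne)})
    (a : nat -> 'cV[R]_(nu + ny)) : Prop :=
  (forall (k : nat) (j : 'I_nu), j \notin U -> a k (lshift ny j) 0 = 0) /\
  (forall (k : nat) (s : 'I_ny),
     lshift ne s \notin Y -> a k (rshift nu s) 0 = 0).

Definition actively_uses (R : realType) (nu ny : nat) (i : 'I_nu)
    (a : nat -> 'cV[R]_(nu + ny)) : Prop :=
  exists k, a k (lshift ny i) 0 != 0.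

(* Binary matrices are boolean matrices; the rank of [B] is that of the
   corresponding real 0/1 matrix.  The requirement that the nonzero entries of
   [B] stay nonzero constrains realizations and is part of [realization]. *)

Definition structural_assumption (R : realType) (nx nu p : nat)
    (SB : 'M[bool]_(nx, nu)) (SC : 'M[bool]_(p, nx)) : Prop :=
  [/\ exists f : 'I_nu -> 'I_nx, SB = \matrix_(i, j) (i == f j),
      \rank (map_mx (fun b : bool => b%:R : R) SB) = nu
    & exists g : 'I_p -> 'I_nx, SC = \matrix_(i, j) (j == g i)].

Definition realization (R : realType) (nx nu p : nat)
    (SA : 'M[bool]_nx) (SB : 'M[bool]_(nx, nu)) (SC : 'M[bool]_(p, nx))
    (A : 'M[R]_nx) (B : 'M[R]_(nx, nu)) (C : 'M[R]_(p, nx)) : Prop :=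
  [/\ forall i j, ~~ SA i j -> A i j = 0,
      forall i j, ~~ SB i j -> B i j = 0,
      forall i j, SB i j -> B i j != 0
    & forall i j, ~~ SC i j -> C i j = 0].

Inductive node (nx nu p : nat) : Type :=
  | State of 'I_nx
  | Actuator of 'I_nu
  | Sensor of 'I_p
  | Target.

Arguments State {nx nu p}.
Arguments Actuator {nx nu p}.
Arguments Sensor {nx nu p}.
Arguments Target {nx nu p}.

Section NodeFinType.
Variables nx nu p : nat.

Definition node_code (v : node nx nu p) : option ('I_nx + 'I_nu + 'I_p) :=
  match v with
  | State j => Some (inl (inl j))
  | Actuator j => Some (inl (inr j))
  | Sensor j => Some (inr j)
  | Target => None
  end.

Definition node_decode (c : option ('I_nx + 'I_nu + 'I_p)) : node nx nu p :=
  match c with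
  | Some (inl (inl j)) => State j
  | Some (inl (inr j)) => Actuator j
  | Some (inr j) => Sensor j
  | None => Target
  end.

Lemma node_codeK : cancel node_code node_decode.
Proof. by case. Qed.

HB.instance Definition _ := Finite.copy (node nx nu p) (can_type node_codeK).

End NodeFinType.

Definition vertex_separator (V : finType) (e : rel V) (va vb : V)
    (S : {set V}) : bool :=
  [&& va \notin S, vb \notin S
    & ~~ connect [rel v w | [&& v \notin S, w \notin S & e v w]] va vb].

Section RobustIndex.
Variables (nx nu ny ne : nat).
Variables (SA : 'M[bool]_nx) (SB : 'M[bool]_(nx, nu))
          (SC : 'M[bool]_(ny + ne, nx)).

Definition extended_edge : rel (node nx nu (ny + ne)) := fun v w =>
  match v, w with
  | Actuator j, State i => SB i j
  | State j, State i => SA i j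
  | State j, Sensor i => SC i j
  | Sensor _, Target => true
  | _, _ => false
  end.

Definition robust_admissible (i : 'I_nu)
    (UY : {set 'I_nu} * {set 'I_(ny + ne)}) : bool :=
  let X := [set j : 'I_nx |
    [exists k in UY.1 :\ i, extended_edge (Actuator k) (State j)]] in
  [&& i \in UY.1,
      [forall s in UY.2, unprotected s]
    & vertex_separator extended_edge (Actuator i) Target
        ([set State j | j in X] :|: [set Sensor s | s in UY.2])].

Definition robust_security_index (i : 'I_nu) : \bar int :=
  \big[Order.min/+oo%E]_(UY : {set 'I_nu} * {set 'I_(ny + ne)} |
      robust_admissible i UY) (#|UY.1| + #|UY.2|)%N%:Z%:E.

End RobustIndex.

(* Main.v *)
(* The pair (Ua, Ya) is itself admissible for the robust security index.
   Otherwise a simple path u_i -> x_0 -> ... -> x_m -> y_s -> t avoids Ya and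
   every state driven by another attacked actuator; keeping only the entries of
   A and C on this path yields a realization that merely delays u_i by m + 1
   steps on its way to the unattacked sensor y_s, so an undetectable attack
   cannot use u_i. *)

Require Import Defs.
From mathcomp Require Import all_boot all_order all_algebra.
From mathcomp Require Import reals constructive_ereal.

Set Implicit Arguments.
Unset Strict Implicit.
Unset Printing Implicit Defensive.

Import Order.TTheory GRing.Theory Num.Theory.
Local Open Scope ring_scope.

(** States lead only to states and sensors, sensors only to [Target], and [Target] has no successor.
    The relation is transposed because column indices of [SA] are edge sources. *)
Lemma path_to_target (nx nu ny ne : nat)
    (SA : 'M[bool]_nx) (SB : 'M[bool]_(nx, nu)) (SC : 'M[bool]_(ny + ne, nx))
    (j : 'I_nx) (p : seq (node nx nu (ny + ne))) :
  path (extended_edge SA SB SC) (State j) p -> last (State j) p = Target ->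
  exists q s, [/\ p = map State q ++ [:: Sensor s; Target],
                  path (fun x y => SA y x) j q & SC s (last j q)].
Proof.
elim: p j => [//|v p IHp] j /= /andP[].
case: v => // [x|s] /= e_jv path_p last_p.
  have [q [s [-> path_q SCs]]] := IHp _ path_p last_p.
  by exists (x :: q), s; split=> //=; rewrite e_jv.
case: p path_p last_p {IHp} => [//|[x|k|s'|] p] //= path_p _.
by exists [::], s; case: p path_p => [|v p] //=.
Qed.

Section DelayLine.
Variables (R : realType) (nx nu ny ne : nat).
Variables (x0 : 'I_nx) (q : seq 'I_nx) (s : 'I_(ny + ne)).
Hypothesis uniq_q : uniq (x0 :: q).

(** Since [x0 :: q] is [q] shifted by one place, the [nth] term is the predecessor of [x] on the
    path. *)
Definition delay_mx : 'M[R]_nx :=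
  \matrix_(x, y) ((x \in q) && (y == nth x0 (x0 :: q) (index x q)))%:R.

Definition readout_mx : 'M[R]_(ny + ne, nx) :=
  \matrix_(r, y) ((r == s) && (y == last x0 q))%:R.

Variable B : 'M[R]_(nx, nu).
Variable a : nat -> 'cV[R]_(nu + ny).

Lemma attack_input_mxE k x :
  (attack_input_mx ny B *m a k) x 0 = \sum_j B x j * a k (lshift ny j) 0.
Proof.
rewrite mxE big_split_ord /= [X in _ + X]big1 ?addr0 => [|j _].
  by apply: eq_bigr => j _; rewrite row_mxEl.
by rewrite row_mxEr mxE mul0r.
Qed.

Lemma state_delay_head k :
  state delay_mx B a k.+1 x0 0 = \sum_j B x0 j * a k (lshift ny j) 0.
Proof.
rewrite /= mxE attack_input_mxE mxE big1 ?add0r // => y _.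
by case/andP: uniq_q => /negPf x0Nq _; rewrite mxE x0Nq mul0r.
Qed.

(** Position [l] in [q] is position [l.+1] in [x0 :: q]: without input, the signal moves one place
    along the path per time step. *)
Lemma state_delay_step k l : (l < size q)%N ->
  (forall j, B (nth x0 q l) j * a k (lshift ny j) 0 = 0) ->
  state delay_mx B a k.+1 (nth x0 q l) 0
    = state delay_mx B a k (nth x0 (x0 :: q) l) 0.
Proof.
move=> lt_l noinput; case/andP: uniq_q => _ uq.
rewrite /= mxE attack_input_mxE [X in _ + X]big1 ?addr0 => [|j _]; last exact: noinput.
rewrite mxE (bigD1 (nth x0 (x0 :: q) l)) //= mxE mem_nth // index_uniq //.
rewrite eqxx mul1r big1 ?addr0 // => y /negPf yN.
by rewrite mxE mem_nth // index_uniq //= yN mul0r.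
Qed.

Lemma output_readout k (Ya : {set 'I_(ny + ne)}) (Ua : {set 'I_nu}) :
  uses_only Ua Ya a -> s \notin Ya ->
  output delay_mx B readout_mx a k s 0 = state delay_mx B a k (last x0 q) 0.
Proof.
move=> [_ useY] sNY; rewrite /output mxE.
have ->: (attack_output_mx R nu ny ne *m a k) s 0 = 0.
  rewrite -[a k]vsubmxK mul_block_col !mul0mx add0r mul1mx addr0.
  (* An unprotected [s] lies outside [Ya], so its attack entry vanishes; a protected one has a zero
     row in the attack matrix. *)
  move: sNY; rewrite -[s]splitK; case: (split s) => r /= rNY.
    by rewrite col_mxEu mxE useY.
  by rewrite col_mxEd mxE.
rewrite addr0 mxE (bigD1 (last x0 q)) //= mxE !eqxx mul1r big1 ?addr0 //.
by move=> y /negPf yN; rewrite mxE yN andbF mul0r.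
Qed.

End DelayLine.

Lemma realization_delay (R : realType) (nx nu ny ne : nat)
    (SA : 'M[bool]_nx) (SB : 'M[bool]_(nx, nu)) (SC : 'M[bool]_(ny + ne, nx))
    (x0 : 'I_nx) (q : seq 'I_nx) (s : 'I_(ny + ne)) :
  path (fun x y => SA y x) x0 q -> SC s (last x0 q) ->
  realization SA SB SC (delay_mx R x0 q) (map_mx (fun b : bool => b%:R) SB)
    (readout_mx R x0 q s).
Proof.
move=> path_q SCs; split=> x y; rewrite !mxE.
- case: andP => //= -[xq /eqP->].
  have := pathP x0 path_q (index x q); rewrite index_mem nth_index // => /(_ xq).
  by move->.
- by move/negPf->.
- by move->; rewrite oner_eq0.
- by case: andP => //= -[/eqP-> /eqP->]; rewrite SCs.
Qed.

Lemma attacked_admissible (R : realType) (nx nu ny ne : nat)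
    (SA : 'M[bool]_nx) (SB : 'M[bool]_(nx, nu)) (SC : 'M[bool]_(ny + ne, nx))
    (f : 'I_nu -> 'I_nx) (Ua : {set 'I_nu}) (Ya : {set 'I_(ny + ne)})
    (i : 'I_nu) :
  SB = \matrix_(x, j) (x == f j) ->
  (forall s, s \in Ya -> unprotected s) -> i \in Ua ->
  (forall A B C, realization SA SB SC A B C ->
     exists a : nat -> 'cV[R]_(nu + ny),
       [/\ perfectly_undetectable A B C a, uses_only Ua Ya a
         & actively_uses i a]) ->
  robust_admissible SA SB SC i (Ua, Ya).
Proof.
move=> SBE unprotY iU attack; rewrite /robust_admissible /= iU /=.
apply/andP; split; first by apply/forall_inP.
set X := [set j | _]; set S := (_ :|: _).
have memS v : v \in S = match v with
    State j => j \in X | Sensor r => r \in Ya | _ => false end.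
  rewrite inE; apply/orP/idP => [[] /imsetP[x xS ->] //|].
  by case: v => //= [j jX|r rY]; [left|right]; apply: imset_f.
rewrite /vertex_separator !memS /=; apply/negP => /connectP[p path_p last_p].
(* A simple path is needed: on a repeated state the delay line would not be a chain. *)
case/shortenP: path_p last_p => p' path_p' uniq_p' _ last_p'.
have avoid_p' : all (fun v => v \notin S) p'.
  elim: p' (Actuator i) path_p' {uniq_p' last_p'} => //= v r IHr u.
  by case/andP=> /and3P[_ -> _] /IHr.
have {}path_p' : path (extended_edge SA SB SC) (Actuator i) p'.
  by apply: sub_path path_p' => u v /= /and3P[].
case: p' path_p' last_p' uniq_p' avoid_p' => [|[x0|j|r|] p'] //.
rewrite cons_uniq => /andP[e_ix0 path_p'] /esym last_p' /andP[_].
have SBx0 : SB x0 i := e_ix0.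
have [q [s [-> path_q SCs]]] := path_to_target path_p' last_p'.
rewrite -![State x0 :: _]/(map State (x0 :: q) ++ [:: Sensor s; Target]).
rewrite cat_uniq => /andP[].
rewrite map_inj_uniq => [uniq_q _|x y [] //].
rewrite all_cat all_map => /andP[/allP avoidX] /=.
rewrite memS => /andP[sNY _].
have [a [[_ y0] useUY [k]]] := attack _ _ _ (realization_delay R SB path_q SCs).
set B := map_mx _ SB in y0.
(* Along the path, only actuator [i] acts, and only at [x0]. Actuators outside [Ua] are silent, [i]
   drives the single state [x0], which is not in [q], and states driven by the rest of [Ua] lie in
   the separator. *)
have noinput x j k' : x \in x0 :: q -> (j != i) || (x \in q) ->
    B x j * a k' (lshift ny j) 0 = 0.
  move=> xp ji; rewrite mxE; case SBxj: (SB x j); last by rewrite mul0r.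
  case: (boolP (j \in Ua)) => [jU|jNU]; last by rewrite useUY.1 ?mulr0.
  have [eq_ji|jNi] := eqVneq j i.
    have eq_x: x = x0.
      by move: SBxj SBx0; rewrite eq_ji SBE !mxE => /eqP-> /eqP->.
    by move: uniq_q ji; rewrite eq_ji eqxx eq_x /= => /andP[/negPf->].
  have := avoidX x xp; rewrite /= memS /X inE => /existsP[]; exists j.
  by rewrite !inE jNi jU /= SBxj.
(* Induction on the distance [m] to the observed end of the path. All times are covered at once,
   since the value at place [l] and time [k'] is read at place [l.+1] and time [k'.+1]. *)
have state0 m l k' : (l + m)%N = size q ->
    state (delay_mx R x0 q) B a k' (nth x0 (x0 :: q) l) 0 = 0.
  elim: m l k' => [|m IHm] l k' lm.
    rewrite -(addn0 l) lm -last_nth -(output_readout x0 q B k' useUY sNY).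
    by rewrite y0 mxE.
  have lt_l : (l < size q)%N by rewrite -lm addnS ltnS leq_addr.
  rewrite -(state_delay_step uniq_q lt_l) => [|j].
    by apply: (IHm l.+1); rewrite addSnnS.
  by apply: noinput; rewrite ?inE mem_nth ?orbT.
(* At time [k.+1] the state [x0] holds exactly the entry of [a k] for actuator [i], nonzero by the
   choice of [k]. *)
have := state0 (size q) 0%N k.+1 (add0n _).
rewrite (state_delay_head uniq_q) (bigD1 i) //= big1 => [|j jNi].
  by rewrite addr0 mxE SBx0 mul1r => ->; rewrite eqxx.
by apply: noinput; rewrite ?mem_head ?jNi.
Qed.

Theorem proposition4 (R : realType) (nx nu ny ne : nat)
    (SA : 'M[bool]_nx) (SB : 'M[bool]_(nx, nu)) (SC : 'M[bool]_(ny + ne, nx))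
    (hS : structural_assumption R SB SC)
    (Ua : {set 'I_nu}) (Ya : {set 'I_(ny + ne)})
    (hYa : forall s, s \in Ya -> unprotected s)
    (i : 'I_nu) (hi : i \in Ua)
    (hattack : forall (A : 'M[R]_nx) (B : 'M[R]_(nx, nu))
                      (C : 'M[R]_(ny + ne, nx)),
       realization SA SB SC A B C ->
       exists a : nat -> 'cV[R]_(nu + ny),
         [/\ perfectly_undetectable A B C a,
             uses_only Ua Ya a
           & actively_uses i a]) :
  (robust_security_index SA SB SC i <= (#|Ua| + #|Ya|)%N%:Z%:E)%E.
Proof.
have [[f SBE] _ _] := hS.
exact: bigmin_le_cond (attacked_admissible SBE hYa hi hattack).
Qed.
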